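(* Let $G_{1,1}$ be the group with presentation $\langle a,b,c,d,s,t \mid c=ab=ba,\ d=ab^{-1},\ s^{-1}as=c,\ t^{-1}at=d\rangle$ and let $X=\{a^{\pm1},b^{\pm1},c^{\pm1},d^{\pm1},s^{\pm1},t^{\pm1}\}$. Then there is no geodesic automatic structure for $(G_{1,1},X)$; that is, there is no automatic structure $L\subseteq X^*$ for $(G_{1,1},X)$ all of whose words are geodesic.
   Context: $X^*$ is the set of all finite words in the letters of $X$, including the empty word. $\Gamma(G,X)$ is the Cayley graph with each edge of length 1 and the path metric $d$. A word $w\in X^*$ is identified with the path it labels starting at the identity; $|w|$ is its number of letters, $\overline w$ its endpoint, and for real $t\ge 0$, $w(t)$ is the point at distance $t$ along the path $w$ if $t<|w|$, and $w(t)=\overline w$ if $t\ge|w|$. A word is geodesic if no shorter word over $X$ represents the same group element. Two words $w,u$ $k$-fellow travel if $d(w(t),u(t))\le k$ for all real $t\ge 0$. A language $L\subseteq X^*$ has the fellow traveler property if there is a constant $k$ such that any $w,u\in L$ with $d(\overline w,\overline u)\le 1$ $k$-fellow travel. An automatic structure for $(G,X)$ is a language $L\subseteq X^*$ that is regular (accepted by some finite state automaton), has the fellow traveler property, and surjects onto $G$. *)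

(* Defs.v *)
From HB Require Import structures.
From mathcomp Require Import all_boot all_order all_algebra.
From mathcomp Require Import boolp classical_sets reals.

Set Implicit Arguments.
Unset Strict Implicit.
Unset Printing Implicit Defensive.

Import Order.TTheory GRing.Theory Num.Theory.

Local Open Scope quotient_scope.
Local Open Scope classical_set_scope.
Local Open Scope ring_scope.

(* The letter (x, false) stands for x and (x, true) for x^-1, so that a language
   over the alphabet X^{+-1} is a set (word X). *)
Definition letter (X : Type) : Type := (X * bool)%type.
Definition word (X : Type) : Type := seq (letter X).

HB.instance Definition _ (X : choiceType) := Choice.on (letter X).
HB.instance Definition _ (X : choiceType) := Choice.on (word X).

Definition pos (X : Type) (x : X) : letter X := (x, false).
Definition neg (X : Type) (x : X) : letter X := (x, true).
Definition linv (X : Type) (l : letter X) : letter X := (l.1, ~~ l.2).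
Definition winv (X : Type) (w : word X) : word X := rev (map (@linv X) w).

Section Presentation.
Variables (X : choiceType) (E : seq (word X * word X)).

(* The congruence on words over X^{+-1} whose quotient is the group with
   presentation < X | u = v, (u, v) in E >. *)
Inductive pres_eq : word X -> word X -> Prop :=
| pres_refl u : pres_eq u u
| pres_sym u v : pres_eq u v -> pres_eq v u
| pres_trans u v w : pres_eq u v -> pres_eq v w -> pres_eq u w
| pres_cat u u' v v' : pres_eq u u' -> pres_eq v v' -> pres_eq (u ++ v) (u' ++ v')
| pres_free l : pres_eq [:: l; linv l] [::]
| pres_rel u v : (u, v) \in E -> pres_eq u v.

Definition pres_eqb (u v : word X) : bool := `[< pres_eq u v >].

Lemma pres_eqb_equiv : equiv_class_of pres_eqb.
Proof.
split=> [u|u v|v u w].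
- exact/asboolP/pres_refl.
- by apply/asboolP/asboolP; apply: pres_sym.
- by move=> /asboolP uv /asboolP vw; apply/asboolP/(pres_trans uv).
Qed.

Canonical pres_eqb_rel := EquivRelPack pres_eqb_equiv.

Definition presented_group : Type := {eq_quot pres_eqb}.
HB.instance Definition _ := Choice.on presented_group.

Definition pres_class (w : word X) : presented_group := \pi_{eq_quot pres_eqb} w.
Definition pres_repr (g : presented_group) : word X := repr (g : {eq_quot pres_eqb}).

Lemma pres_classP u v : pres_class u = pres_class v <-> pres_eq u v.
Proof.
by split=> [/eqP|uv]; [rewrite eqmodE => /asboolP|apply/eqP; rewrite eqmodE; apply/asboolP].
Qed.

Lemma pres_reprK g : pres_class (pres_repr g) = g.
Proof. exact: reprK. Qed.

Lemma pres_repr_class w : pres_eq (pres_repr (pres_class w)) w.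
Proof. exact/pres_classP/pres_reprK. Qed.

Lemma linvK : involutive (@linv X).
Proof. by move=> [x b]; rewrite /linv /= negbK. Qed.

Lemma pres_mulV w : pres_eq (w ++ winv w) [::].
Proof.
elim: w => [|l w IH]; first exact: pres_refl.
have -> : (l :: w) ++ winv (l :: w) = [:: l] ++ (w ++ winv w) ++ [:: linv l].
  by rewrite /winv /= rev_cons -cats1 catA.
apply: pres_trans (pres_free l).
apply: (@pres_cat [:: l] [:: l] _ [:: linv l] (pres_refl _)).
exact: (pres_cat IH (pres_refl _)).
Qed.

Lemma winvK : involutive (@winv X).
Proof. by move=> w; rewrite /winv map_rev revK -map_comp map_id_in // => l _; exact: linvK. Qed.

Lemma pres_Vmul w : pres_eq (winv w ++ w) [::].
Proof. by rewrite -{2}[w]winvK; exact: pres_mulV. Qed.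

Definition pres_one : presented_group := pres_class [::].
Definition pres_mul (g h : presented_group) : presented_group :=
  pres_class (pres_repr g ++ pres_repr h).
Definition pres_inv (g : presented_group) : presented_group :=
  pres_class (winv (pres_repr g)).

Lemma pres_mul_class u v :
  pres_mul (pres_class u) (pres_class v) = pres_class (u ++ v).
Proof. by apply/pres_classP/pres_cat; exact: pres_repr_class. Qed.

Lemma pres_mulA : associative pres_mul.
Proof.
move=> g h k; rewrite -[g]pres_reprK -[h]pres_reprK -[k]pres_reprK.
by rewrite !pres_mul_class catA.
Qed.

Lemma pres_mul1g : left_id pres_one pres_mul.
Proof. by move=> g; rewrite -[g]pres_reprK pres_mul_class. Qed.

Lemma pres_mulg1 : right_id pres_one pres_mul.
Proof. by move=> g; rewrite -[g]pres_reprK pres_mul_class cats0. Qed.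

Lemma pres_mulVg : left_inverse pres_one pres_inv pres_mul.
Proof.
move=> g; rewrite /pres_inv -{2}[g]pres_reprK pres_mul_class.
exact/pres_classP/pres_Vmul.
Qed.

Lemma pres_mulgV : right_inverse pres_one pres_inv pres_mul.
Proof.
move=> g; rewrite /pres_inv -{1}[g]pres_reprK pres_mul_class.
exact/pres_classP/pres_mulV.
Qed.

HB.instance Definition _ := isGroup.Build presented_group
  pres_mulA pres_mul1g pres_mulg1 pres_mulVg pres_mulgV.

Definition pres_gen (x : X) : presented_group := pres_class [:: pos x].

End Presentation.

Section Cayley.
Variables (R : realType) (G : groupType) (X : Type) (gen : X -> G).

Definition letter_val (l : letter X) : G :=
  (if l.2 then (gen l.1)^-1 else gen l.1)%g.

Definition word_val (w : word X) : G := (\prod_(l <- w) letter_val l)%g.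

Definition geodesic (w : word X) : Prop :=
  forall u, word_val u = word_val w -> (size w <= size u)%N.

(* The geometric realization of the Cayley graph.  There is one edge (g, x) from
   g to g * gen x for each g and each generator x; the edge labelled x^-1 from
   g * gen x to g is the same edge traversed backwards.  EdgeInt g x r is the
   point at distance r from g in the interior of the edge (g, x). *)
Inductive cayley_point : Type :=
| Vertex of G
| EdgeInt of G & X & {r : R | 0 < r < 1}.

(* The characteristic map [0, 1] -> Gamma of the edge (g, x). *)
Definition edge_point (g : G) (x : X) (r : R) : cayley_point :=
  if insub r is Some r' then EdgeInt g x r'
  else if r <= 0 then Vertex g else Vertex (g * gen x)%g.

(* pl_path p q len: there is a piecewise linear path of length len from p to q,
   each piece being a segment contained in one closed edge. *)
Inductive pl_path : cayley_point -> cayley_point -> R -> Prop :=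
| pl_nil p : pl_path p p 0
| pl_cons g x (r s : R) q len :
    0 <= r <= 1 -> 0 <= s <= 1 -> pl_path (edge_point g x s) q len ->
    pl_path (edge_point g x r) q (`|r - s| + len).

(* The infimum is over a nonempty set as soon as gen generates G, the graph
   being then connected. *)
Definition path_dist (p q : cayley_point) : R := inf [set len | pl_path p q len].

Definition letter_point (g : G) (l : letter X) (t : R) : cayley_point :=
  if l.2 then edge_point (g * (gen l.1)^-1)%g l.1 (1 - t) else edge_point g l.1 t.

Fixpoint path_point (g : G) (w : word X) (t : R) : cayley_point :=
  if w is l :: w' then
    if t < 1 then letter_point g l t
    else path_point (g * letter_val l)%g w' (t - 1)
  else Vertex g.

(* w(t), for t >= 0; it is constantly equal to the endpoint for t >= size w. *)
Definition word_point (w : word X) (t : R) : cayley_point := path_point 1%g w t.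

Definition k_fellow_travel (k : R) (w u : word X) : Prop :=
  forall t : R, 0 <= t -> path_dist (word_point w t) (word_point u t) <= k.

Definition fellow_traveler_property (L : set (word X)) : Prop :=
  exists k : R, forall w u, L w -> L u ->
    path_dist (Vertex (word_val w)) (Vertex (word_val u)) <= 1 ->
    k_fellow_travel k w u.

End Cayley.

Lemma word_val_pres (X : choiceType) (E : seq (word X * word X)) (w : word X) :
  word_val (pres_gen E) w = pres_class E w.
Proof.
have classM u v : pres_class E (u ++ v) = (pres_class E u * pres_class E v)%g.
  by rewrite -[RHS]/(pres_mul _ _) pres_mul_class.
rewrite /word_val; elim: w => [|[x b] w IH]; first by rewrite big_nil.
rewrite big_cons IH -[in RHS]cat1s classM; congr (_ * _)%g.
case: b => //; rewrite /letter_val /=; apply: (mulgI (pres_gen E x)).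
rewrite mulgV /pres_gen -classM; apply/esym/pres_classP.
exact: (pres_free _ (pos x)).
Qed.

Record automaton (A : Type) := Automaton {
  state : finType;
  init : state;
  final : {set state};
  trans : state -> A -> state
}.

Definition accepts (A : Type) (M : automaton A) (w : seq A) : bool :=
  foldl (@trans A M) (init M) w \in final M.

Definition regular (A : Type) (L : set (seq A)) : Prop :=
  exists M : automaton A, forall w, L w <-> accepts M w.

Definition automatic_structure (R : realType) (G : groupType) (X : Type)
    (gen : X -> G) (L : set (word X)) : Prop :=
  [/\ regular L,
      fellow_traveler_property R gen L
    & forall g : G, exists2 w, L w & word_val gen w = g].

(* A geodesic language may contain several representatives of an element. *)
Definition geodesic_automatic_structure (R : realType) (G : groupType)
    (X : Type) (gen : X -> G) (L : set (word X)) : Prop :=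
  automatic_structure R gen L /\ forall w, L w -> geodesic gen w.

Inductive gen11 : Type := Ga | Gb | Gc | Gd | Gs | Gt.

Definition gen11_to (x : gen11) : 'I_6 :=
  match x with
  | Ga => inord 0 | Gb => inord 1 | Gc => inord 2
  | Gd => inord 3 | Gs => inord 4 | Gt => inord 5
  end.

Definition gen11_of (i : 'I_6) : gen11 := nth Ga [:: Ga; Gb; Gc; Gd; Gs; Gt] i.

Lemma gen11_toK : cancel gen11_to gen11_of.
Proof. by case; rewrite /gen11_of /= inordK. Qed.

HB.instance Definition _ := Finite.copy gen11 (can_type gen11_toK).

Definition rel11 : seq (word gen11 * word gen11) :=
  [:: ([:: pos Gc], [:: pos Ga; pos Gb]);
      ([:: pos Ga; pos Gb], [:: pos Gb; pos Ga]);
      ([:: pos Gd], [:: pos Ga; neg Gb]);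
      ([:: neg Gs; pos Ga; pos Gs], [:: pos Gc]);
      ([:: neg Gt; pos Ga; pos Gt], [:: pos Gd])].

Definition G11 : groupType := presented_group rel11.
Definition X11 (x : gen11) : G11 := pres_gen rel11 x.

(* Main.v *)
Require Import Defs.
From mathcomp Require Import all_boot all_order all_algebra.
From mathcomp Require Import boolp classical_sets reals.
From mathcomp Require Import zify lra.

(** The fellow traveler property fails: for every k there are two adjacent
elements of the group such that no geodesic of the one k-fellow travels with a
geodesic of the other.

Write K = 2^n and consider

   g0 = c^-1 s^(n+1) c^K d s^-n   and   g1 = g0 c^-1.

In the tree of flats (the cosets of <a, b>, glued along lines by the strips of
s and t) a path to g0 or g1 climbs n + 1 flats through s, reaches a diagonal
line c^-1 s^(n+1) c^j of a top flat, moves by d to a parallel line and descends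
through n flats.  It must meet that diagonal line, and the question is for
which j.  The word metric of a flat is the maximum norm, so in the diagonal
coordinates p = (x + y) / 2 and q = (x - y) / 2 it is |p| + |q|.  A path that
enters a flat along the diagonal q = 0 and leaves it along the line y = 0 leaves
it at x = 2 p, and repeating this at every level turns the distance from the
identity to the point j of the l-th diagonal line into

   profile l j = l + 1 + |j| - [2^l <= 2 j] - [2^l <= j],

the two corrections being a rounding effect that happens at exponentially
distant places.  The same function describes the distance from g1 down to the
second line, with K - j in place of j, whereas for g0 the corrections are
absent.  Adding up, a path of minimal length K + 2 n + 2 crosses only at j = K
when it goes to g0, and only at j = 0 when it goes to g1
([goal0_crossing], [goal1_crossing]).  So after n + 2 letters the geodesic to
g1 is at the top, at level n + 1; the geodesic to g0 is then forced to use the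
exponentially growing steps d^(2^i) between its letters s and is still at a much
lower level ([corner_level]).  The level is a 1-Lipschitz
function, so the two points are far apart.

The lower bounds come from an action of the group on the flats that such paths
have to meet, in which every other branch of the tree is collapsed onto the line
from which it hangs; this is possible because the homomorphism a, c, d -> 1 and
b, s, t -> 0 is injective on every gluing line ([walk_pres]).  Each lower bound is the value of an integer function on that set
that changes by at most 1 under a generator ([potential_walk]).  The upper
bound K + 2 n + 2 comes from explicit words ([short0_val], [short1_val]). *)

Set Implicit Arguments.
Unset Strict Implicit.
Unset Printing Implicit Defensive.

Import Order.TTheory GRing.Theory Num.Theory.

Local Open Scope ring_scope.

(** * Profiles on a line and their extension to a flat *)

Definition line_lip (f : int -> int) : Prop := forall j : int, `|f (j + 1) - f j| <= 1.

Definition flat_lip (F : int -> int -> int) : Prop := forall x y : int,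
  [/\ `|F (x + 1) y - F x y| <= 1, `|F x (y + 1) - F x y| <= 1,
      `|F (x + 1) (y + 1) - F x y| <= 1 & `|F (x + 1) (y - 1) - F x y| <= 1].

(** The distance to a line in a flat: if f is the distance from a base point to
the points (j, j) of the diagonal, then every path leaving the diagonal extends
it as f (p) + |q|, with p = (x + y) / 2 and q = (x - y) / 2.  When x + y is odd,
p is a half-integer and the better of its two integer neighbours is used. *)
Definition spread (f : int -> int) (x y : int) : int :=
  Num.min (f ((x + y) %/ 2)%Z) (f ((x + y + 1) %/ 2)%Z) + ((`|x - y| + 1) %/ 2)%Z.

Lemma flat_parity (x y : int) :
  exists p q : int, (x = p + q \/ x = p + q + 1) /\ y = p - q.
Proof. by exists ((x + y) %/ 2)%Z, (((x + y) %/ 2)%Z - y); lia. Qed.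

Lemma spread_even f (p q x y : int) :
  x = p + q -> y = p - q -> spread f x y = f p + `|q|.
Proof.
move=> -> ->; rewrite /spread.
have -> : ((p + q + (p - q)) %/ 2)%Z = p by lia.
have -> : ((p + q + (p - q) + 1) %/ 2)%Z = p by lia.
by lia.
Qed.

Lemma spread_odd f (p q x y : int) : x = p + q + 1 -> y = p - q ->
  spread f x y = Num.min (f p) (f (p + 1)) + Num.max (q + 1) (- q).
Proof.
move=> -> ->; rewrite /spread.
have -> : ((p + q + 1 + (p - q)) %/ 2)%Z = p by lia.
have -> : ((p + q + 1 + (p - q) + 1) %/ 2)%Z = p + 1 by lia.
by lia.
Qed.

Lemma spread_lip f : line_lip f -> flat_lip (spread f).
Proof.
move=> f_lip x y; have [p [q [[xE|xE] yE]]] := flat_parity x y.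
  rewrite (spread_even f xE yE).
  rewrite (@spread_odd f p q (x + 1) y); try lia.
  rewrite (@spread_odd f p (q - 1) x (y + 1)); try lia.
  rewrite (@spread_even f (p + 1) q (x + 1) (y + 1)); try lia.
  rewrite (@spread_even f p (q + 1) (x + 1) (y - 1)); try lia.
  by have fp := f_lip p; split; lia.
rewrite (spread_odd f xE yE).
rewrite (@spread_even f (p + 1) (q + 1) (x + 1) y); try lia.
rewrite (@spread_even f (p + 1) q x (y + 1)); try lia.
rewrite (@spread_odd f (p + 1) q (x + 1) (y + 1)); try lia.
rewrite (@spread_odd f p (q + 1) (x + 1) (y - 1)); try lia.
by have fp := f_lip p; have fp1 := f_lip (p + 1); split; lia.
Qed.

(** The distance from the point (1, 1) of the flat at level 0 to the points of
the diagonal line of the flat at level l: [profile 0 j = |j - 1|], and the next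
levels follow from [profile_rec]. *)
Definition profile (l : nat) (j : int) : int :=
  l%:Z + 1 + `|j| - (if (2 ^ l)%:Z <= 2 * j then 1 else 0)
                  - (if (2 ^ l)%:Z <= j then 1 else 0).

Lemma profile_lip l : line_lip (profile l).
Proof.
move=> j; rewrite /profile.
have : (0 < 2 ^ l)%N by rewrite expn_gt0.
set q := (2 ^ l)%N; clearbody q => q_gt0.
by do !case: ifP => ?; lia.
Qed.

(** The horizontal line y = 0 of a flat is glued to the diagonal of the next
one, by a letter s of length 1.  At x = 2 p the spread is f (p) + |p|, so the
corrections of [profile l] reappear at twice the distance. *)
Lemma profile_rec l (x : int) : profile l.+1 x = spread (profile l) x 0 + 1.
Proof.
have q_parity : (2 ^ l = 1 \/ exists2 q, 2 ^ l = 2 * q & 0 < q)%N.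
  case: l => [|l]; first by left.
  by right; exists (2 ^ l)%N; rewrite ?expnS // expn_gt0.
have [p [r [[xE|xE] yE]]] := flat_parity x 0.
  rewrite (spread_even _ xE yE) /profile expnS.
  by case: q_parity => [->|[q -> q_gt0]]; do !case: ifP => ?; lia.
rewrite (spread_odd _ xE yE) /profile expnS.
by case: q_parity => [->|[q -> q_gt0]]; do !case: ifP => ?; lia.
Qed.

(** * The action of the group on glued flats *)

(** A right action of the group on a set of flats indexed by I.  A flat has
three families of gluing lines: the a-lines y = h, the c-lines x - y = h and the
d-lines - (x + y) = h.  The letter s carries a-lines to c-lines and t carries
a-lines to d-lines; [glue e t i h] is the other side of the strip of the letter
s ([t = false]) or t ([t = true]) that leaves the flat i, where [e] tells whether
the letter is read forwards, that is, whether the strip is entered at its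
a-line.  In all flats x is the value of the homomorphism a, c, d -> 1 and
b, s, t -> 0, so that gluing preserves x. *)
Section Complex.

Variable I : Type.
Variable glue : bool -> bool -> I -> int -> option (I * int).

Hypothesis glueK : forall e t i h j k,
  glue e t i h = Some (j, k) -> glue (~~ e) t j k = Some (i, h).

(** Where a line is not glued to another flat, the branch behind it is replaced
by a ray of lines, numbered by nat and all parametrized by x; moving along the
ray keeps the action of s or t bijective.  [Hanging t e i h k] is the k-th line of
the ray that hangs from the line of the flat i with coordinate h. *)
Inductive place : Type :=
| Flat of I & int
| Hanging of bool & bool & I & int & nat.

Definition location : Type := (int * place)%type.

(** The coordinate h of the gluing line through (x, y).  The sign in the case of
d-lines makes it an involution in y, so that it also recovers y from h. *)
Definition line_coord (e t : bool) (x y : int) : int :=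
  if e then y else if t then - (x + y) else x - y.

Lemma line_coordK e t (x : int) : involutive (line_coord e t x).
Proof. by move=> y; rewrite /line_coord; case: e; case: t; lia. Qed.

Definition shift (dx dy : int) (w : location) : location :=
  match w with
  | (x, Flat i y) => (x + dx, Flat i (y + dy))
  | (x, Hanging t e i h k) => (x + dx, Hanging t e i h k)
  end.

(** A ray hanging from a line that is glued elsewhere is not attached to
anything; it has to be fixed pointwise for [cross] to be a bijection. *)
Definition cross (e t : bool) (w : location) : location :=
  match w with
  | (x, Flat i y) =>
      if glue e t i (line_coord e t x y) is Some (j, h)
      then (x, Flat j (line_coord (~~ e) t x h))
      else (x, Hanging t e i (line_coord e t x y) 0)
  | (x, Hanging t' e' i h k) =>
      if (t != t') || glue e' t i h then w
      else if e == e' then (x, Hanging t e' i h k.+1)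
      else if k is k'.+1 then (x, Hanging t e' i h k')
      else (x, Flat i (line_coord e' t x h))
  end.

Lemma crossK e t : cancel (cross e t) (cross (~~ e) t).
Proof.
move=> [x [i y|t' e' i h k]] /=.
  case gE: (glue e t i _) => [[j h]|] /=.
    by rewrite line_coordK (glueK gE) negbK line_coordK.
  by rewrite eqxx gE /= line_coordK; case: e {gE}.
case: (t =P t') => [<-|tt'] /=; last by case: eqP tt'.
case gE: (glue e' t i h) => [p|] /=; first by rewrite eqxx gE.
case: eqP => [->|ee'] /=; first by rewrite eqxx gE /=; case: e' {gE}.
have {ee'}-> : ~~ e = e' by case: (e) (e') ee' => [] [].
case: k => [|k] /=; first by rewrite line_coordK gE.
by rewrite eqxx gE eqxx.
Qed.

Definition act (w : location) (l : letter gen11) : location :=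
  let sg := if l.2 then -1 else 1 in
  match l.1 with
  | Ga => shift sg 0 w
  | Gb => shift 0 sg w
  | Gc => shift sg sg w
  | Gd => shift sg (- sg) w
  | Gs => cross (~~ l.2) false w
  | Gt => cross (~~ l.2) true w
  end.

Definition walk (w : location) (u : word gen11) : location := foldl act w u.

Lemma shift_shift dx dy dx' dy' w :
  shift dx dy (shift dx' dy' w) = shift (dx' + dx) (dy' + dy) w.
Proof. by case: w => [x [i y|t e i h k]] /=; rewrite ?addrA. Qed.

Lemma shift0 w : shift 0 0 w = w.
Proof. by case: w => [x [i y|t e i h k]] /=; rewrite ?addr0. Qed.

(** The relations a s = s c and a t = t d: an a-line y = h goes to a c-line or
d-line along which x advances in the same way. *)
Lemma cross_shift t w :
  cross true t (shift 1 0 w) = shift 1 (if t then -1 else 1) (cross true t w).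
Proof.
case: w => [x [i y|t' e' i h k]] /=.
  rewrite addr0; case: (glue true t i y) => [[j h]|] //=.
  by congr (_, Flat _ _); case: t; lia.
case: eqP => //= _; case: (glue e' t i h) => [p|] //=.
case: e' => //=; case: k => //= .
by congr (_, Flat _ _); case: t; lia.
Qed.

Lemma act_linv w l : act (act w l) (linv l) = w.
Proof.
case: l => [[] []] //=; rewrite /act /= ?shift_shift ?(addrN, addNr, opprK) ?shift0 //;
  exact: (crossK true) || exact: (crossK false).
Qed.

Lemma walk_rel u v : (u, v) \in rel11 -> forall w, walk w u = walk w v.
Proof.
have key t w : cross true t (shift 1 0 (cross false t w)) = shift 1 (if t then -1 else 1) w.
  by rewrite cross_shift (crossK false).
rewrite !inE => H w.
by do ?case/predU1P: H => [[-> ->]|H]; last case/eqP: H => -> ->;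
  rewrite /walk /= /act /= ?key ?shift_shift.
Qed.

(** By this, a walk on the glued flats depends only on the element of the group
that its word represents. *)
Lemma walk_pres u v : pres_eq rel11 u v -> forall w, walk w u = walk w v.
Proof.
elim=> {u v} [//|u v _ IH w|u v x _ IH1 _ IH2 w|u u' v v' _ IH1 _ IH2 w|l w|].
- by rewrite IH.
- by rewrite IH1 IH2.
- by rewrite /walk !foldl_cat [foldl _ w u]IH1 [LHS]IH2.
- exact: act_linv.
- exact: walk_rel.
Qed.

Variable F : I -> int -> int -> int.

Hypothesis F_lip : forall i, flat_lip (F i).

Hypothesis F_glue : forall t i (y : int) j (h x : int), glue true t i y = Some (j, h) ->
  `|F j x (line_coord false t x h) - F i x y| <= 1.

(** A hanging line takes the values of the line that carries it: this is the
collapse of the branches of the tree. *)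
Definition potential (w : location) : int :=
  match w with
  | (x, Flat i y) => F i x y
  | (x, Hanging t e i h _) => F i x (line_coord e t x h)
  end.

Lemma potential_cross e t w : `|potential (cross e t w) - potential w| <= 1.
Proof.
case: w => [x [i y|t' e' i h k]] /=.
  case gE: (glue e t i _) => [[j h]|] /=; last by rewrite line_coordK subrr.
  case: e gE => /= gE; first exact: F_glue.
  have := F_glue x (glueK gE); rewrite line_coordK distrC; exact.
case: eqP => [<-|] /=; last by rewrite subrr.
case: (glue e' t i h) => [p|] /=; first by rewrite subrr.
by case: eqP => _ /=; [|case: k => [|k] /=]; rewrite subrr.
Qed.

Lemma potential_act w l : `|potential (act w l) - potential w| <= 1.
Proof.
have pos_shift w' : [/\ `|potential (shift 1 0 w') - potential w'| <= 1,
    `|potential (shift 0 1 w') - potential w'| <= 1,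
    `|potential (shift 1 1 w') - potential w'| <= 1
    & `|potential (shift 1 (-1) w') - potential w'| <= 1].
  case: w' => [x [i y|t e i h k]] /=; first by rewrite !addr0; exact: F_lip.
  have [Fa Fb Fc Fd] := F_lip i x (line_coord e t x h).
  have Ed : - (x + 1 + h) = - (x + h) - 1 by lia.
  have Ec : x + 1 - h = x - h + 1 by lia.
  rewrite !addr0 subrr /line_coord.
  by case: e t Fa Fb Fc Fd => [] [] /=; rewrite ?Ed ?Ec; split.
have neg_shift dx dy w' : potential (shift (- dx) (- dy) w') - potential w' =
    - (potential (shift dx dy (shift (- dx) (- dy) w')) -
       potential (shift (- dx) (- dy) w')).
  by rewrite shift_shift !addNr shift0 opprB.
case: l => [[] []]; rewrite /act /= ?potential_cross //;
  try (by have [] := pos_shift w).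
- by rewrite -{1}oppr0 neg_shift normrN oppr0; have [] := pos_shift (shift (-1) 0 w).
- by rewrite -{1}oppr0 neg_shift normrN oppr0; have [] := pos_shift (shift 0 (-1) w).
- by rewrite neg_shift normrN; have [] := pos_shift (shift (-1) (-1) w).
- by rewrite neg_shift normrN; have [] := pos_shift (shift (-1) (- - 1) w).
Qed.

(** The source of all lower bounds on word lengths. *)
Lemma potential_walk w u : `|potential (walk w u) - potential w| <= (size u)%:Z.
Proof.
elim: u w => [|l u IH] w /=; first by rewrite subrr.
have := IH (act w l); have := potential_act w l; rewrite /walk /=; lia.
Qed.

End Complex.

(** * The two towers of flats and their distance functions *)

(** The flats met by the paths to g0 and g1.  The near tower [(false, l)] with
0 <= l <= n has its base at x = y = 0 in each flat, and its a-line through the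
base is glued to the c-line through the base of the next flat.  The far tower
[(true, l)] has its base at (K + 1, K - 1).  Its top flat [(true, n)] is also the
last step of the near tower, whose line is the diagonal x = y; this diagonal and
the c-line x - y = 2 of the far tower differ by one letter d. *)
Section Chain.

Variable n : nat.

Let K : int := (2 ^ n)%:Z.

Definition flat_index : Type := (bool * nat)%type.

Definition glue_up (i : flat_index) (y : int) : option (flat_index * int) :=
  match i with
  | (false, l) =>
      if y == 0 then
        if (l < n)%N then Some ((false, l.+1), 0)
        else if l == n then Some ((true, n), 0) else None
      else None
  | (true, l) =>
      if (y == K - 1) && (l < n)%N then Some ((true, l.+1), 2) else None
  end.

Definition glue_down (i : flat_index) (h : int) : option (flat_index * int) :=
  match i with
  | (false, l) =>
      if (h == 0) && (0 < l <= n)%N then Some ((false, l.-1), 0) else None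
  | (true, l) =>
      if (h == 2) && (0 < l <= n)%N then Some ((true, l.-1), K - 1)
      else if (h == 0) && (l == n) then Some ((false, n), 0) else None
  end.

Definition chain_glue (e t : bool) : flat_index -> int -> option (flat_index * int) :=
  if t then fun _ _ => None else if e then glue_up else glue_down.

Lemma chain_glueK e t i h j k :
  chain_glue e t i h = Some (j, k) -> chain_glue (~~ e) t j k = Some (i, h).
Proof.
case: t => //; case: e; case: i => [[] l] /=.
- case: ifP => //= /andP[/eqP-> l_n] [<- <-] /=.
  by rewrite l_n.
- case: eqP => // ->; case: ifP => [l_n [<- <-]|_] /=; first by rewrite l_n.
  by case: eqP => // -> [<- <-] /=; rewrite eqxx.
- case: ifP => [/andP[/eqP-> /andP[l_gt0 l_n]]|_].
    by move=> [<- <-] /=; rewrite eqxx prednK ?l_n //; case: l l_gt0 l_n.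
  by case: ifP => // /andP[/eqP-> /eqP->] [<- <-] /=; rewrite ltnn eqxx.
- case: ifP => // /andP[/eqP-> /andP[l_gt0 l_n]] [<- <-] /=.
  by rewrite prednK // l_n.
Qed.

Lemma chain_glue_lip (F : flat_index -> int -> int -> int) :
    (forall l x, (l < n)%N -> `|F (false, l.+1) x x - F (false, l) x 0| <= 1) ->
    (forall x, `|F (true, n) x x - F (false, n) x 0| <= 1) ->
    (forall l x, (l < n)%N ->
      `|F (true, l.+1) x (x - 2) - F (true, l) x (K - 1)| <= 1) ->
  forall t i (y : int) j (h x : int), chain_glue true t i y = Some (j, h) ->
  `|F j x (line_coord false t x h) - F i x y| <= 1.
Proof.
move=> F_near F_turn F_far [] // [[] l] y j h x /=.
  by case: ifP => //= /andP[/eqP-> l_n] [<- <-]; exact: F_far.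
case: eqP => // ->; case: ifP => [l_n [<- <-]|_].
  by rewrite subr0; exact: F_near.
by case: eqP => // -> [<- <-]; rewrite subr0; exact: F_turn.
Qed.

Local Notation walk := (walk chain_glue).
Local Notation location := (location flat_index).

(** The distance from [start].  The far tower below its top is collapsed to the
line x - y = 2 from which it hangs, where x - 1 is the coordinate p. *)
Definition from_start (i : flat_index) (x y : int) : int :=
  match i with
  | (false, l) => spread (profile l) x y
  | (true, l) =>
      if l == n then spread (profile n.+1) x y else profile n.+1 (x - 1) + 1
  end.

(** The distance to [goal0], which is the base of the flat [(true, 0)].  The near
tower is collapsed to the diagonal x = y of the top flat. *)
Definition to_goal0 (i : flat_index) (x y : int) : int :=
  match i with
  | (false, l) => n%:Z + 1 + `|x - K|
  | (true, l) => l%:Z + Num.max `|x - (K + 1)| `|y - (K - 1)|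
  end.

(** The distance to [goal1]: seen from the base of the far tower and reversed,
this goal is the point (1, 1), as [start] is for the near tower. *)
Definition to_goal1 (i : flat_index) (x y : int) : int :=
  match i with
  | (false, l) => profile n (K - x) + 1
  | (true, l) => spread (profile l) (K + 1 - x) (K - 1 - y)
  end.

(** The distance to the point (K, K) of the top flat.  Going down one level
halves the position of the nearest point, hence the powers of 2. *)
Definition to_corner (i : flat_index) (x y : int) : int :=
  match i with
  | (false, l) =>
      n%:Z + 1 - l%:Z + (K - (2 ^ l)%:Z) + Num.max `|x - (2 ^ l)%:Z| `|y|
  | (true, l) =>
      if l == n then Num.max `|x - K| `|y - K| else `|x - 1 - K| + 1
  end.

Definition level (i : flat_index) (x y : int) : int :=
  match i with
  | (false, l) => l%:Z
  | (true, l) => n%:Z + 1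
  end.

Definition one_lip (F : flat_index -> int -> int -> int) : Prop :=
  forall w u, `|potential F (walk w u) - potential F w| <= (size u)%:Z.

Lemma one_lip_chain F : (forall i, flat_lip (F i)) ->
    (forall l x, (l < n)%N -> `|F (false, l.+1) x x - F (false, l) x 0| <= 1) ->
    (forall x, `|F (true, n) x x - F (false, n) x 0| <= 1) ->
    (forall l x, (l < n)%N ->
      `|F (true, l.+1) x (x - 2) - F (true, l) x (K - 1)| <= 1) ->
  one_lip F.
Proof.
move=> F_flat F_near F_turn F_far; apply: (potential_walk chain_glueK F_flat).
exact: chain_glue_lip.
Qed.

Lemma flat_lip_line f : line_lip f -> flat_lip (fun x _ => f x).
Proof. by move=> f_lip x y; rewrite subrr; split. Qed.

Lemma flat_lip_opp (a b : int) F : flat_lip F -> flat_lip (fun x y => F (a - x) (b - y)).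
Proof.
move=> F_lip x y.
have Ex : a - x = a - (x + 1) + 1 by lia.
have Ey : b - y = b - (y + 1) + 1 by lia.
have Ey' : b - (y - 1) = b - y + 1 by lia.
have [Fa _ Fc _] := F_lip (a - (x + 1)) (b - (y + 1)).
have [_ Fb _ _] := F_lip (a - x) (b - (y + 1)).
have [Fa' _ _ Fd] := F_lip (a - (x + 1)) (b - y).
rewrite -Ex -Ey in Fa Fc Fb Fa' Fd; split; rewrite distrC //.
have [_ _ _] := F_lip (a - (x + 1)) (b - (y - 1)).
by rewrite -Ex Ey' addrK.
Qed.

Lemma line_lip_add f (a b : int) : line_lip f -> line_lip (fun x => f (x + a) + b).
Proof.
move=> f_lip x /=; have -> : x + 1 + a = x + a + 1 by lia.
by have := f_lip (x + a); lia.
Qed.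

Lemma line_lip_sub f (a b : int) : line_lip f -> line_lip (fun x => f (a - x) + b).
Proof.
move=> f_lip x /=; have -> : a - x = a - (x + 1) + 1 by lia.
by have := f_lip (a - (x + 1)); lia.
Qed.

Lemma max_norm_lip (a b c : int) :
  flat_lip (fun x y => c + Num.max `|x - a| `|y - b|).
Proof. by move=> x y; split; lia. Qed.

Lemma line_lip_dist (a b : int) : line_lip (fun x => b + `|x - a|).
Proof. by move=> x; lia. Qed.

Lemma spread_on_diag f (x : int) : spread f x x = f x.
Proof. by rewrite (@spread_even f x 0) ?addr0 ?subr0. Qed.

Lemma from_start_lip : one_lip from_start.
Proof.
apply: one_lip_chain => [[[] l]|l x l_n|x|l x l_n] /=.
- move=> x y /=; case: (l =P n) => _; first exact: spread_lip (@profile_lip _) x y.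
  exact: flat_lip_line (line_lip_add _ _ (@profile_lip _)) x y.
- exact/spread_lip/profile_lip.
- by rewrite spread_on_diag profile_rec; lia.
- by rewrite eqxx spread_on_diag profile_rec; lia.
- rewrite (ltn_eqF l_n); case: (l.+1 =P n) => _; last by rewrite subrr.
  by rewrite (@spread_even _ (x - 1) 1); lia.
Qed.

Lemma to_goal0_lip : one_lip to_goal0.
Proof.
apply: one_lip_chain => [[[] l]|l x l_n|x|l x l_n] /=.
- exact: max_norm_lip.
- exact/flat_lip_line/line_lip_dist.
- by lia.
- by lia.
- by lia.
Qed.

Lemma to_goal1_lip : one_lip to_goal1.
Proof.
apply: one_lip_chain => [[[] l]|l x l_n|x|l x l_n] /=.
- exact/flat_lip_opp/spread_lip/profile_lip.
- exact/flat_lip_line/line_lip_sub/profile_lip.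
- by lia.
- by rewrite (@spread_even _ (K - x) 1) ?normr1 ?subrr //; lia.
- have -> : K - 1 - (x - 2) = K + 1 - x by lia.
  by rewrite spread_on_diag subrr profile_rec addrAC subrr.
Qed.

Lemma to_corner_lip : one_lip to_corner.
Proof.
apply: one_lip_chain => [[[] l]|l x l_n|x|l x l_n] /=.
- by move=> x y /=; case: (l =P n) => _; split; lia.
- by have := @max_norm_lip (2 ^ l)%:Z 0 (n%:Z + 1 - l%:Z + (K - (2 ^ l)%:Z)) => H x y;
    have := H x y; rewrite !subr0.
- by rewrite expnS; set q := (2 ^ l)%N; clearbody q; lia.
- by rewrite eqxx /K; set q := (2 ^ n)%N; clearbody q; lia.
- by rewrite (ltn_eqF l_n); case: (l.+1 =P n) => _; lia.
Qed.

Lemma level_lip : one_lip level.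
Proof.
by apply: one_lip_chain => [[[] l] x y|l x l_n|x|l x l_n] /=; rewrite ?subrr //; lia.
Qed.

(** * Crossing points of short paths *)

Definition far (w : location) : bool :=
  match w.2 with Flat i _ => i.1 | Hanging _ _ i _ _ => i.1 end.

Lemma far_shift dx dy w : far (shift dx dy w) = far w.
Proof. by case: w => [x []]. Qed.

Lemma far_cross e t w : ~~ far w -> far (cross chain_glue e t w) ->
  exists j, cross chain_glue e t w = (j, Flat (true, n) j).
Proof.
case: w => [x [[[] l] y|t' e' [[] l] h k]] //= _.
  case gE: (chain_glue _ _ _ _) => [[[b m] h]|] //=.
  case: t gE => //; case: e => /=; last by case: ifP => // _ [<-].
  case: eqP => // y0; case: ifP => [_ [<-] //|_]; case: eqP => // _ [<- <- <-] _.
  by exists x; rewrite subr0.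
case: (_ || _) => //; case: eqP => //= _.
by case: k.
Qed.

Lemma far_act w l : ~~ far w -> far (act chain_glue w l) ->
  exists j, act chain_glue w l = (j, Flat (true, n) j).
Proof.
move=> w_near; case: l => [[] b]; rewrite /act /= ?far_shift ?(negPf w_near) //;
  exact: far_cross.
Qed.

(** Only the strip between [(false, n)] and the diagonal of [(true, n)] joins the
two towers. *)
Lemma crossing w u : ~~ far w -> far (walk w u) ->
  exists u1 u2 j, u = u1 ++ u2 /\ walk w u1 = (j, Flat (true, n) j).
Proof.
elim: u w => [|l u IH] w w_near; first by rewrite /= (negPf w_near).
move=> u_far; case: (boolP (far (act chain_glue w l))) => [l_far|l_near].
  by have [j wj] := far_act w_near l_far; exists [:: l], u, j.
have [u1 [u2 [j [-> wj]]]] := IH _ l_near u_far.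
by exists (l :: u1), u2, j.
Qed.

Definition start : location := (1, Flat (false, 0%N) 1).
Definition goal0 : location := (K + 1, Flat (true, 0%N) (K - 1)).
Definition goal1 : location := (K, Flat (true, 0%N) (K - 2)).
Definition corner (j : int) : location := (j, Flat (true, n) j).

Lemma walk_cat w u v : walk w (u ++ v) = walk (walk w u) v.
Proof. exact: foldl_cat. Qed.

Lemma from_start_corner j : potential from_start (corner j) = profile n.+1 j.
Proof. by rewrite /= eqxx spread_on_diag. Qed.

(** Cutting a path at the diagonal: its first part costs at least the profile,
and the second part at least the distance F of the crossing to the goal. *)
Lemma crossing_split F u goal : one_lip F -> far goal -> potential F goal = 0 ->
    walk start u = goal ->
  exists u1 u2 j, [/\ u = u1 ++ u2, walk start u1 = corner j,
    profile n.+1 j <= (size u1)%:Z & potential F (corner j) <= (size u2)%:Z].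
Proof.
move=> F_lip goal_far F_goal u_goal.
have [|u1 [u2 [j [uE u1j]]]] := @crossing start u isT; first by rewrite u_goal.
exists u1, u2, j; split=> //.
  have := from_start_lip start u1; rewrite u1j from_start_corner.
  have -> : potential from_start start = 0 by [].
  by lia.
have := F_lip (walk start u1) u2.
by rewrite -walk_cat -uE u_goal F_goal u1j /corner; lia.
Qed.

(** On 0 <= j <= K the total profile (n + 1) j + (n + 1) + (K - j) is constant
except for the correction at j = K. *)
Lemma goal0_crossing u : walk start u = goal0 -> (size u <= 2 ^ n + 2 * n + 2)%N ->
  exists u1 u2, [/\ u = u1 ++ u2, walk start u1 = corner K & size u1 = (2 ^ n + n + 1)%N].
Proof.
move=> u_goal u_short.
have [||u1 [u2 [j [uE u1j le_u1 le_u2]]]] := crossing_split to_goal0_lip _ _ u_goal => //.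
  by rewrite /=; lia.
have q_gt0 : (0 < 2 ^ n)%N by rewrite expn_gt0.
have [jK u1_size] : j = K /\ size u1 = (2 ^ n + n + 1)%N.
  move: le_u1 le_u2 u_short; rewrite uE size_cat /= /profile expnS /K.
  by set q := (2 ^ n)%N in q_gt0 *; clearbody q; do !case: ifP => ?; lia.
by exists u1, u2; rewrite -jK.
Qed.

(** Going to g1 the total is profile (n + 1) j + 1 + profile n (K - j).  The first
term has its correction at j = K, but the second has one from K - j >= K / 2 on and
another at K - j = K, so j = 0 gains two. *)
Lemma goal1_crossing u : walk start u = goal1 -> (size u <= 2 ^ n + 2 * n + 2)%N ->
  exists u1 u2, [/\ u = u1 ++ u2, walk start u1 = corner 0 & size u1 = n.+2].
Proof.
move=> u_goal u_short.
have [||u1 [u2 [j [uE u1j le_u1 le_u2]]]] := crossing_split to_goal1_lip _ _ u_goal => //.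
  by rewrite /= (@spread_even _ 1 0) //; lia.
have q_gt0 : (0 < 2 ^ n)%N by rewrite expn_gt0.
have [j0 u1_size] : j = 0 /\ size u1 = n.+2.
  move: le_u1 le_u2 u_short; rewrite uE size_cat /= (@spread_even _ (K - j) 1); try lia.
  rewrite /profile expnS /K.
  by set q := (2 ^ n)%N in q_gt0 *; clearbody q; do !case: ifP => ?; lia.
by exists u1, u2; rewrite -j0.
Qed.

Lemma potential_at (w : location) : exists i x y, forall F, potential F w = F i x y.
Proof.
case: w => [x [i y|t e i h k]]; first by exists i, x, y.
by exists i, x, (line_coord e t x h).
Qed.

Lemma profile_ge l (j : int) :
  l.+1%:Z + 1 + `|j| <= profile l.+1 j \/ l.+1%:Z + (2 ^ l)%:Z <= profile l.+1 j.
Proof.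
have q_gt0 : (0 < 2 ^ l)%N by rewrite expn_gt0.
rewrite /profile expnS; set q := (2 ^ l)%N in q_gt0 *; clearbody q.
by do !case: ifP => ?; lia.
Qed.

(** Away from the corrections the distance is the maximum norm; where they
matter, the distance is exponential. *)
Lemma spread_profile_ge l (x y : int) :
  l.+1%:Z + 1 + Num.max `|x| `|y| <= spread (profile l.+1) x y \/
  l.+1%:Z + (2 ^ l)%:Z <= spread (profile l.+1) x y.
Proof.
have [p [q [[xE|xE] yE]]] := flat_parity x y.
  by rewrite (spread_even _ xE yE); have := profile_ge l p; lia.
rewrite (spread_odd _ xE yE).
by have := profile_ge l p; have := profile_ge l (p + 1); lia.
Qed.

(** The point reached after n + 2 letters is at distance at most n + 2 from the
start and at most K - 1 from the corner (K, K).  At level l the latter forces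
x >= n + 2 - l, whereas the former bounds l + 1 + x by n + 2, unless the rounding
corrections at 2^(l-1) come into play, which are out of reach at the levels
l > n - k. *)
Lemma corner_level k u : (2 * k + 2 <= n)%N -> walk start u = corner K ->
  size u = (2 ^ n + n + 1)%N ->
  potential level (walk start (take n.+2 u)) < n%:Z + 1 - k%:Z.
Proof.
move=> kn u_corner u_size; set v := walk start _.
have n_q : (n < 2 ^ n)%N by exact: ltn_expl.
have v_start : potential from_start v <= n%:Z + 2.
  have := from_start_lip start (take n.+2 u); rewrite -/v.
  have -> : potential from_start start = 0 by [].
  by rewrite size_take u_size; case: ifP; lia.
have v_corner : potential to_corner v <= K - 1.
  have := to_corner_lip v (drop n.+2 u).
  rewrite -walk_cat cat_take_drop u_corner size_drop u_size /= eqxx /K; lia.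
have [[[] l] [x [y vE]]] := potential_at v; rewrite !vE /= in v_start v_corner *.
  case: (l =P n) v_start v_corner => _.
    by have := spread_profile_ge n x y; rewrite /K; lia.
  by have := profile_ge n (x - 1); rewrite /K; lia.
case: l v_start v_corner {vE} => [|l]; first lia.
have := spread_profile_ge l x y; have := @ltn_expl 2 l isT.
rewrite expnS /K; set q := (2 ^ l)%N; set r := (2 ^ n)%N in n_q *.
clearbody q r; lia.
Qed.

(** A word for g0 that is easy to follow in the chain of flats, although far from
geodesic. *)
Definition word0 : word gen11 :=
  neg Gc :: nseq n.+1 (pos Gs) ++ nseq (2 ^ n) (pos Gc) ++ pos Gd :: nseq n (neg Gs).

Lemma walk_nseq_shift (f : letter gen11) dx dy m x i y :
    (forall w, act chain_glue w f = shift dx dy w) ->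
  walk (x, Flat i y) (nseq m f) = (x + dx *+ m, Flat i (y + dy *+ m)).
Proof.
move=> fE; elim: m x y => [|m IH] x y; first by rewrite !addr0.
by rewrite /= fE /= [LHS]IH !mulrS !addrA.
Qed.

Lemma walk_up m : (m <= n)%N ->
  walk (0, Flat (false, 0%N) 0) (nseq m (pos Gs)) = (0, Flat (false, m) 0).
Proof.
elim: m => [//|m IH] m_n.
rewrite -[m.+1]addn1 nseqD walk_cat IH ?(ltnW m_n) //=.
by rewrite /act /= m_n addn1 subrr.
Qed.

Lemma walk_down m : (m <= n)%N ->
  walk (K + 1, Flat (true, n) (K - 1)) (nseq m (neg Gs)) =
  (K + 1, Flat (true, n - m)%N (K - 1)).
Proof.
elim: m => [|m IH] m_n; first by rewrite subn0.
rewrite -[m.+1]addn1 nseqD walk_cat IH ?(ltnW m_n) //=.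
rewrite /act /= /line_coord.
have -> : K + 1 - (K - 1) == 2 by lia.
have -> : (0 < n - m <= n)%N by lia.
by rewrite addn1 -subnS.
Qed.

Lemma walk_word0 : walk start word0 = goal0.
Proof.
rewrite /word0 -cat1s -addn1 nseqD -!catA !walk_cat /=.
rewrite walk_up // /act /= ltnn eqxx /= subr0.
rewrite (@walk_nseq_shift _ 1 1) //= /act /= !natz !add0r -/K.
by rewrite walk_down // subnn.
Qed.

Lemma walk_word1 : walk start (rcons word0 (neg Gc)) = goal1.
Proof.
rewrite -cats1 walk_cat walk_word0 /= /goal1 /act /= addrK.
by have -> : K - 1 - 1 = K - 2 by lia.
Qed.

End Chain.

(** * Short words for the two endpoints *)

Section WordValue.

Variables (G : groupType) (X : Type) (gen : X -> G).

Lemma word_val_nil : word_val gen [::] = 1%g.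
Proof. by rewrite /word_val big_nil. Qed.

Lemma word_val_cons l u : word_val gen (l :: u) = (letter_val gen l * word_val gen u)%g.
Proof. by rewrite /word_val big_cons. Qed.

Lemma word_val_cat u v : word_val gen (u ++ v) = (word_val gen u * word_val gen v)%g.
Proof. by rewrite /word_val big_cat. Qed.

Lemma word_val_nseq m l : word_val gen (nseq m l) = (letter_val gen l ^+ m)%g.
Proof.
by elim: m => [|m IH]; rewrite ?word_val_nil //= word_val_cons IH expgS.
Qed.

Lemma word_val_winv u : word_val gen (winv u) = ((word_val gen u)^-1)%g.
Proof.
elim: u => [|[x b] u IH]; first by rewrite word_val_nil invg1.
rewrite /winv /= rev_cons -cats1 word_val_cat IH !word_val_cons word_val_nil mulg1 invgM.
by case: b; rewrite /letter_val /= ?invgK.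
Qed.

End WordValue.

Lemma intertwineX (G : groupType) (x y s : G) m :
  (x * s = s * y -> x ^+ m * s = s * y ^+ m)%g.
Proof.
move=> xs; elim: m => [|m IH]; first by rewrite mul1g mulg1.
by rewrite expgS -mulgA IH mulgA xs -mulgA -expgS.
Qed.

(** The path that climbs the flats along the nearest points, whose positions
double at each level. *)
Fixpoint ladder (l : letter gen11) (m : nat) : word gen11 :=
  if m is m'.+1 then ladder l m' ++ rcons (nseq (2 ^ m') l) (pos Gs) else [::].

Lemma size_ladder l m : ((size (ladder l m)).+1 = 2 ^ m + m)%N.
Proof.
elim: m => [//|m IH] /=.
by rewrite size_cat size_rcons size_nseq expnS; lia.
Qed.

(** Each step uses c^q d^q s = (c d)^q s = s c^(2 q) with q = 2^m.  It is applied to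
(c, d) and to (c^-1, d^-1). *)
Lemma ladder_val (G : groupType) (gen : gen11 -> G) (c : G) l m :
    commute c (letter_val gen l) ->
    (c * letter_val gen l * gen Gs = gen Gs * c ^+ 2)%g ->
  word_val gen (ladder l m) = (c^-1 * gen Gs ^+ m * c ^+ (2 ^ m))%g.
Proof.
move=> cl cls; elim: m => [|m IH] /=.
  by rewrite word_val_nil mulg1 mulVg.
rewrite word_val_cat IH -cats1 word_val_cat word_val_nseq word_val_cons word_val_nil mulg1.
rewrite {2}/letter_val /= expgSr expnS expgnA -!mulgA; congr (_ * (_ * _))%g.
by rewrite -(intertwineX _ cls) expgMn // mulgA.
Qed.

Section Presentation11.

Local Notation A := (X11 Ga).
Local Notation B := (X11 Gb).
Local Notation C := (X11 Gc).
Local Notation D := (X11 Gd).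
Local Notation S := (X11 Gs).

Lemma rel11_val u v : (u, v) \in rel11 -> word_val X11 u = word_val X11 v.
Proof. by move=> uv; rewrite !word_val_pres; apply/pres_classP/pres_rel. Qed.

Lemma c_val : C = (A * B)%g.
Proof.
have := @rel11_val [:: pos Gc] [:: pos Ga; pos Gb].
rewrite !(word_val_cons, word_val_nil) !mulg1 /letter_val /= => -> //.
by rewrite !inE eqxx.
Qed.

Lemma commute_ab : commute A B.
Proof.
have := @rel11_val [:: pos Ga; pos Gb] [:: pos Gb; pos Ga].
rewrite !(word_val_cons, word_val_nil) !mulg1; apply.
by rewrite !inE eqxx ?orbT.
Qed.

Lemma d_val : D = (A * B^-1)%g.
Proof.
have := @rel11_val [:: pos Gd] [:: pos Ga; neg Gb].
rewrite !(word_val_cons, word_val_nil) !mulg1 /letter_val /= => -> //.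
by rewrite !inE eqxx ?orbT.
Qed.

Lemma mul_as : (A * S = S * C)%g.
Proof.
have := @rel11_val [:: neg Gs; pos Ga; pos Gs] [:: pos Gc].
rewrite !(word_val_cons, word_val_nil) !mulg1 /letter_val /= => <-.
  by rewrite mulVKg.
by rewrite !inE eqxx ?orbT.
Qed.

Lemma mul_cd : (C * D = A ^+ 2)%g.
Proof. by rewrite c_val d_val -mulgA (mulgA B) -commute_ab mulgK. Qed.

Lemma commute_cd : commute C D.
Proof.
by rewrite /commute mul_cd c_val d_val commute_ab mulgA mulgVK.
Qed.

Lemma mul_cds : (C * D * S = S * C ^+ 2)%g.
Proof. by rewrite mul_cd (intertwineX _ mul_as). Qed.

Lemma conj_cs : (C^-1 * (S * C) = B^-1 * S)%g.
Proof. by rewrite -mul_as mulgA c_val invgM mulgVK. Qed.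

Variable n : nat.

(** The exponent n + 1 of s in g0 exceeds by one the height of the ladder: the
first letters are b^-1 s = c^-1 s c. *)
Definition short0 : word gen11 :=
  [:: neg Gb, pos Gs & ladder (pos Gd) n ++ pos Gd :: nseq n (neg Gs)].

Definition short1 : word gen11 :=
  neg Gc :: nseq n.+1 (pos Gs) ++ pos Gd :: winv (ladder (neg Gd) n).

Lemma size_short0 : size short0 = (2 ^ n + 2 * n + 2)%N.
Proof.
by rewrite /= size_cat /= size_nseq; have := size_ladder (pos Gd) n; lia.
Qed.

Lemma size_short1 : size short1 = (2 ^ n + 2 * n + 2)%N.
Proof.
rewrite /= size_cat /= !size_nseq size_rev size_map.
by have := size_ladder (neg Gd) n; lia.
Qed.

Lemma val_word0 : word_val X11 (word0 n) =
  (C^-1 * S ^+ n.+1 * C ^+ (2 ^ n) * D * S ^- n)%g.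
Proof.
rewrite /word0 word_val_cons !word_val_cat !word_val_nseq word_val_cons word_val_nseq.
by rewrite /letter_val /= expVgn !mulgA.
Qed.

Lemma short0_val : word_val X11 short0 = word_val X11 (word0 n).
Proof.
rewrite val_word0 !word_val_cons word_val_cat.
rewrite (@ladder_val _ _ C) //; [|exact: commute_cd|exact: mul_cds].
rewrite word_val_cons word_val_nseq /letter_val /= expVgn !mulgA; congr (_ * _ * _ * _)%g.
by rewrite -conj_cs !mulgA mulgK expgS !mulgA.
Qed.

Lemma short1_val : word_val X11 short1 = word_val X11 (rcons (word0 n) (neg Gc)).
Proof.
rewrite -cats1 word_val_cat val_word0 !word_val_cons word_val_cat word_val_nseq.
rewrite word_val_cons word_val_winv word_val_nil (@ladder_val _ _ (C^-1)) //.
- rewrite /letter_val /= !mulg1 invgK !expVgn !invgM !invgK expgS !mulgA.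
  congr (_ * _ * _)%g; rewrite -!mulgA; do 3 congr (_ * _)%g.
  exact: commuteX (commute_sym commute_cd).
- exact: commuteV (commute_sym (commuteV (commute_sym commute_cd))).
rewrite /letter_val /= expVgn -invgM -commute_cd.
by apply: (mulgI (C * D)%g); rewrite mulVKg mulgA mul_cds mulgK.
Qed.

End Presentation11.

(** * Distances in the Cayley graph *)

Section CayleyDistance.

Local Open Scope classical_set_scope.

Variables (R : realType) (G : groupType) (X : Type) (gen : X -> G).

Local Notation pl_path := (@pl_path R G X gen).
Local Notation path_dist := (@path_dist R G X gen).
Local Notation edge_point := (@edge_point R G X gen).

Lemma edge_point0 g x : edge_point g x 0 = Vertex _ _ g.
Proof. by rewrite /edge_point insubF ?ltxx ?lexx. Qed.

Lemma edge_point1 g x : edge_point g x 1 = Vertex _ _ (g * gen x)%g.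
Proof. by rewrite /edge_point insubF ?ltxx ?andbF ?ler10. Qed.

Lemma letter_point0 g l : letter_point gen g l 0 = Vertex R _ g.
Proof.
by case: l => [x []]; rewrite /letter_point /= ?subr0 ?edge_point1 ?edge_point0 ?mulgVK.
Qed.

Lemma path_point_nat g w i :
  path_point gen g w i%:R = Vertex R X (g * word_val gen (take i w))%g.
Proof.
elim: w g i => [|l w IH] g i; first by rewrite /= word_val_nil mulg1.
case: i => [|i] /=; first by rewrite ltr01 letter_point0 word_val_nil mulg1.
by rewrite ltrn1 /= -natr1 addrK IH word_val_cons mulgA.
Qed.

Lemma word_point_nat w i :
  word_point gen w i%:R = Vertex R X (word_val gen (take i w)).
Proof. by rewrite /word_point path_point_nat mul1g. Qed.

Lemma pl_path_word g w :
  pl_path (Vertex _ _ g) (Vertex _ _ (g * word_val gen w)%g) (size w)%:R.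
Proof.
elim: w g => [|[x b] w IH] g; first by rewrite word_val_nil mulg1; constructor.
rewrite word_val_cons mulgA /= -natr1 addrC; case: b => /=.
  have := @pl_cons R G X gen (g / gen x)%g x 1 0 _ _.
  rewrite edge_point1 edge_point0 mulgVK subr0 normr1 !lexx ler01.
  by move=> /(_ _ _ isT isT (IH _)).
have := @pl_cons R G X gen g x 0 1 _ _.
rewrite edge_point0 edge_point1 sub0r normrN1 !lexx ler01.
by move=> /(_ _ _ isT isT (IH _)).
Qed.

Lemma pl_path_ge0 p q len : pl_path p q len -> 0 <= len.
Proof. by elim=> // *; exact: addr_ge0. Qed.

Lemma path_dist_word g w :
  path_dist (Vertex _ _ g) (Vertex _ _ (g * word_val gen w)%g) <= (size w)%:R.
Proof.
apply: ge_inf; last exact: pl_path_word.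
by exists 0 => len /pl_path_ge0.
Qed.

Variable phi : G -> R.

Hypothesis phi_lip : forall g x, `|phi (g * gen x)%g - phi g| <= 1.

Definition interpolate (p : cayley_point R G X) : R :=
  match p with
  | Vertex g => phi g
  | EdgeInt g x r => phi g + val r * (phi (g * gen x)%g - phi g)
  end.

Lemma interpolate_edge g x r : 0 <= r <= 1 ->
  interpolate (edge_point g x r) = phi g + r * (phi (g * gen x)%g - phi g).
Proof.
move=> /andP[r_ge0 r_le1]; rewrite /edge_point; case: insubP => [r' _ <- //|].
rewrite negb_and -!leNgt; case: ifP => [r_le0 _|_].
  have -> : r = 0 by lra.
  by rewrite mul0r addr0.
move=> /= r_ge1; have -> : r = 1 by lra.
by rewrite mul1r addrC subrK.
Qed.

Lemma pl_path_interpolate p q len :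
  pl_path p q len -> `|interpolate p - interpolate q| <= len.
Proof.
elim=> [p'|g x r s q' len' r01 s01 _ IH]; first by rewrite subrr normr0.
apply: le_trans (ler_distD (interpolate (edge_point g x s)) _ _) _.
apply: lerD IH; rewrite !interpolate_edge // opprD addrACA subrr add0r -mulrBl normrM.
by rewrite ler_piMr.
Qed.

(** The word w only provides a path between the two vertices: the infimum of an
empty set would be 0. *)
Lemma path_dist_lip g w :
  `|phi g - phi (g * word_val gen w)%g| <=
    path_dist (Vertex _ _ g) (Vertex _ _ (g * word_val gen w)%g).
Proof.
apply: lb_le_inf; first by exists (size w)%:R; exact: pl_path_word.
by move=> len /pl_path_interpolate.
Qed.

End CayleyDistance.

(** * The failure of the fellow traveler property *)

Lemma G11_word (g : G11) : exists w, word_val X11 w = g.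
Proof. by exists (pres_repr g); rewrite word_val_pres pres_reprK. Qed.

Section Level.

Variable n : nat.

Definition height (g : G11) : int :=
  potential (level n) (walk (chain_glue n) start (pres_repr g)).

Lemma walk_class u v : word_val X11 u = word_val X11 v ->
  walk (chain_glue n) start u = walk (chain_glue n) start v.
Proof.
rewrite !word_val_pres => /pres_classP uv.
exact: (walk_pres (@chain_glueK n) uv).
Qed.

Lemma height_word u : height (word_val X11 u) = potential (level n) (walk (chain_glue n) start u).
Proof.
rewrite /height; congr potential; apply: walk_class.
by rewrite [LHS]word_val_pres pres_reprK.
Qed.

Lemma height_lip g x : `|height (g * X11 x)%g - height g| <= 1.
Proof.
have [u <-] := G11_word g.
have -> : (word_val X11 u * X11 x)%g = word_val X11 (u ++ [:: pos x]).
  by rewrite word_val_cat word_val_cons word_val_nil mulg1.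
by rewrite !height_word walk_cat; exact: level_lip.
Qed.

End Level.

Theorem corollary8p3 (R : realType) :
  ~ exists L : set (word gen11), geodesic_automatic_structure R X11 L.
Proof.
move=> [L [[_ [k0 k0P] L_onto] L_geo]].
pose k := Num.bound `|k0|; pose n := (2 * k + 2)%N.
have [w0 Lw0 w0E] := L_onto (word_val X11 (word0 n)).
have [w1 Lw1 w1E] := L_onto (word_val X11 (rcons (word0 n) (neg Gc))).
have w0_short : (size w0 <= 2 ^ n + 2 * n + 2)%N.
  by rewrite -size_short0; apply: L_geo => //; rewrite short0_val.
have w1_short : (size w1 <= 2 ^ n + 2 * n + 2)%N.
  by rewrite -size_short1; apply: L_geo => //; rewrite short1_val.
have [u1 [v1 [w0_cat u1_corner u1_size]]] :=
  goal0_crossing (etrans (walk_class n w0E) (walk_word0 n)) w0_short.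
have [u2 [v2 [w1_cat u2_corner u2_size]]] :=
  goal1_crossing (etrans (walk_class n w1E) (walk_word1 n)) w1_short.
have adjacent : path_dist X11 (Vertex R _ (word_val X11 w0)) (Vertex R _ (word_val X11 w1)) <= 1.
  rewrite w0E w1E -cats1 word_val_cat.
  exact: (path_dist_word R X11 _ [:: neg Gc]).
(* At this time a geodesic to g1 is at the crossing point, at level n + 1. *)
have := k0P _ _ Lw0 Lw1 adjacent n.+2%:R (ler0n _ _).
rewrite !word_point_nat.
have -> : take n.+2 w1 = u2 by rewrite w1_cat -u2_size take_size_cat.
have -> : take n.+2 w0 = take n.+2 u1.
  by rewrite w0_cat take_cat u1_size; case: ltnP => //; have : (n < 2 ^ n)%N by [exact: ltn_expl]; lia.
set h0 := word_val _ (take _ _); set h1 := word_val _ u2; apply/negP; rewrite -ltNge.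
have [w wE] := G11_word (h0^-1 * h1)%g.
have -> : h1 = (h0 * word_val X11 w)%g by rewrite wE mulVKg.
pose phi g : R := (height n g)%:~R.
have phi_lip g x : `|phi (g * X11 x)%g - phi g| <= 1.
  by rewrite /phi -rmorphB /= -intr_norm lerz1 height_lip.
apply: lt_le_trans (path_dist_lip phi_lip h0 w).
rewrite wE mulVKg /phi -rmorphB /= -intr_norm.
have h0_low : height n h0 < n%:Z + 1 - k%:Z.
  by rewrite height_word; apply: corner_level.
have h1_high : height n h1 = n%:Z + 1 by rewrite height_word u2_corner.
apply: (@lt_le_trans _ _ k%:R); first by apply: le_lt_trans (ler_norm _) _; exact: archi_boundP (normr_ge0 _).
by rewrite h1_high -[k%:R]/(k%:Z%:~R) ler_int; lia.
Qed.
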